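(* Let $q>1$. There exist strictly positive densities $w$ on $\mathbb R^2$ which do not satisfy the Smirnov property with exponent $q$. More precisely, let $w_0:\mathbb R^2\to\mathbb R$ be a strictly positive density, and let $f,g:\mathbb R\to\mathbb R$ be measurable functions that are constant on each interval $[i,i+1)$, $i\ge1$, with values $f_i:=f(i)$, $g_i:=g(i)$, and such that $(x,y)\mapsto f(x)$ and $(x,y)\mapsto g(y)$ belong to $\mathcal L^q(w_0)$. Let $(\theta_i)_{i\ge1}$ be positive numbers with $\sum_{i=1}^\infty\theta_i=1$ such that $$\sum_{i=1}^\infty|f_i|^q\theta_i=\sum_{i=1}^\infty|g_i|^q\theta_i=\infty,\qquad \sum_{i=1}^\infty|f_i|\theta_i<\infty,\quad\sum_{i=1}^\infty|g_i|\theta_i<\infty,\qquad \sum_{i=1}^\infty|f_i+g_i|^q\theta_i<\infty .$$ For $\alpha\in(0,1)$ set $$w(x,y):=\alpha\, w_0(x,y)+(1-\alpha)\sum_{i=1}^\infty\theta_i\,1_{[i,i+1)}(x)\,1_{[i,i+1)}(y).$$ Then $w$ is a strictly positive density on $\mathbb R^2$, the functions $f(x)$ and $g(y)$ belong to $\mathcal L^1(w)$, $f(x)+g(y)\in\mathcal L^q(w)$, but $f(x)\notin\mathcal L^q(w)$ and $g(y)\notin\mathcal L^q(w)$.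
   Context: A strictly positive density on $\mathbb R^2$ is a Lebesgue-measurable function $w:\mathbb R^2\to(0,\infty)$ with integral one. $\mathcal L^r(w)$ ($r\ge1$) is the space of (classes of) measurable $h:\mathbb R^2\to\mathbb R$ with $\int_{\mathbb R^2}|h|^r w\,dx\,dy<\infty$. Functions $f(x)$, $g(y)$ of one variable are regarded as functions on $\mathbb R^2$. Smirnov property with exponent $q$ (in dimension two): whenever $f(x),g(y)\in\mathcal L^1(w)$ and $f(x)+g(y)\in\mathcal L^q(w)$, then $f(x),g(y)\in\mathcal L^q(w)$. *)

(* Defs.v *)
From HB Require Import structures.
From mathcomp Require Import all_boot all_order all_algebra.
From mathcomp Require Import all_classical all_reals all_analysis.

Set Implicit Arguments.
Unset Strict Implicit.
Unset Printing Implicit Defensive.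

Import Order.TTheory GRing.Theory Num.Theory.
Import numFieldNormedType.Exports.

Local Open Scope classical_set_scope.
Local Open Scope ring_scope.

(* The measurable structure that the library puts on [R] and [R * R] is the
   Borel one.  Lebesgue measurability is measurability on the following copies
   of [R] and [R * R], whose measurable sets are the Caratheodory-measurable
   sets of the outer Lebesgue measure, i.e. those of its completion. *)
Notation lebesgue_line R :=
  (caratheodory_type ((wlength (@idfun R))^*)%mu).

Notation lebesgue_plane R :=
  (caratheodory_type ((@lebesgue_measure R \x @lebesgue_measure R)%E^*)%mu).

Definition lebesgue_measure2 (R : realType) : set (lebesgue_plane R) -> \bar R :=
  @completed_measure_extension _ _ _ (@lebesgue_measure R \x @lebesgue_measure R)%E.
HB.instance Definition _ (R : realType) := Measure.on (@lebesgue_measure2 R).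

Definition lebesgue_measurable1 (R : realType) (f : R -> R) : Prop :=
  measurable_fun [set: lebesgue_line R] (f : lebesgue_line R -> R).

Definition lebesgue_measurable2 (R : realType) (h : R * R -> R) : Prop :=
  measurable_fun [set: lebesgue_plane R] (h : lebesgue_plane R -> R).

Definition positive_density (R : realType) (w : R * R -> R) : Prop :=
  [/\ lebesgue_measurable2 w,
      forall z, 0 < w z &
      (\int[@lebesgue_measure2 R]_z (w z)%:E = 1)%E].

(* Membership of (the class of) [h] in L^r(w). *)
Definition Lw (R : realType) (r : R) (w h : R * R -> R) : Prop :=
  lebesgue_measurable2 h /\
  (\int[@lebesgue_measure2 R]_z (`|h z| `^ r * w z)%:E < +oo)%E.

Definition in_x (R : realType) (f : R -> R) : R * R -> R := fun z => f z.1.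
Definition in_y (R : realType) (g : R -> R) : R * R -> R := fun z => g z.2.

Definition smirnov_property (R : realType) (q : R) (w : R * R -> R) : Prop :=
  forall f g : R -> R,
    Lw 1 w (in_x f) -> Lw 1 w (in_y g) ->
    Lw q w (fun z => in_x f z + in_y g z) ->
    Lw q w (in_x f) /\ Lw q w (in_y g).

Definition const_on_unit_intervals (R : realType) (f : R -> R) : Prop :=
  forall i : nat, (1 <= i)%N ->
    forall x : R, x \in `[i%:R, i.+1%:R[ -> f x = f i%:R.

(* At each point at most one term of the real series is nonzero, so its limit
   always exists. *)
Definition diagonal_density (R : realType) (theta : nat -> R) (z : R * R) : R :=
  \big[+%R/0]_(1 <= i <oo)
    (theta i * \1_(`[i%:R, i.+1%:R[) z.1 * \1_(`[i%:R, i.+1%:R[) z.2).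

Definition mixture (R : realType) (alpha : R) (w0 : R * R -> R)
    (theta : nat -> R) (z : R * R) : R :=
  alpha * w0 z + (1 - alpha) * diagonal_density theta z.

(* Main.v *)
(* On the diagonal squares [i, i+1)^2, of area 1, the function f(x) + g(y) is
   the constant f_i + g_i, so the diagonal part of w integrates |f + g|^q to
   sum |f_i + g_i|^q theta_i, where f and g may cancel although neither sum of
   |f_i|^q theta_i and |g_i|^q theta_i converges.  The part alpha w_0 only makes
   w positive: membership in L^r(w) is membership in L^r(w_0) together with
   convergence of the diagonal series. *)
Require Import Defs.
From mathcomp Require Import all_boot all_order all_algebra.
From mathcomp Require Import all_classical all_reals all_analysis.
From mathcomp Require Import measurable_realfun ring.

Set Implicit Arguments.
Unset Strict Implicit.
Unset Printing Implicit Defensive.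

Import Order.TTheory GRing.Theory Num.Theory.
Import numFieldNormedType.Exports.

Local Open Scope classical_set_scope.
Local Open Scope ring_scope.

(** * Integration against a weighted series of indicators of sets of measure one *)

Section DiscreteDensity.
Context d (T : measurableType d) (R : realType) (mu : {measure set T -> \bar R}).
Variables (A : nat -> set T) (theta : nat -> R) (D : T -> R).
Hypothesis mA : forall i, measurable (A i).
Hypothesis theta_gt0 : forall i, (1 <= i)%N -> 0 < theta i.
(** Equating a real value with a series in the extended reals records both the pointwise finiteness
    of the series and its sum. *)
Hypothesis DE : forall z,
  (D z)%:E = (\sum_(1 <= i <oo) (theta i * \1_(A i) z)%:E)%E.

Let term i (z : T) : \bar R := (theta i * \1_(A i) z)%:E.

Let term_ge0 i z : (1 <= i)%N -> (0 <= term i z)%E.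
Proof. by move=> i1; rewrite lee_fin mulr_ge0// ltW// theta_gt0. Qed.

Let measurable_term i : measurable_fun setT (term i).
Proof. by apply/measurable_EFinP/measurable_funM. Qed.

Lemma discrete_density_ge0 z : 0 <= D z.
Proof.
rewrite -lee_fin DE; apply: nneseries_ge0 => i i1 _; exact: term_ge0.
Qed.

Lemma measurable_discrete_density : measurable_fun setT D.
Proof.
apply/measurable_EFinP.
apply: (eq_measurable_fun
  (fun z => \sum_(0 <= i <oo | i \in leq 1) term i z)%E) => [z _|].
  rewrite /= DE [RHS]eseries_cond.
  exact: eq_eseriesl.
by apply: ge0_emeasurable_sum => // k x _ k1; exact: term_ge0.
Qed.

Hypothesis muA : forall i, mu (A i) = 1%E.

(** Tonelli lets the integral enter the nonnegative series. On [A i] the factor [h] is the constant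
    [c i], and [A i] has measure one, so the term of index [i] contributes [c i * theta i]. *)
Lemma integral_discrete_density (h : T -> R) (c : nat -> R) :
  measurable_fun setT h -> (forall z, 0 <= h z) ->
  (forall i z, (1 <= i)%N -> A i z -> h z = c i) ->
  (\int[mu]_z (h z * D z)%:E = \sum_(1 <= i <oo) (c i * theta i)%:E)%E.
Proof.
move=> mh h0 hc.
(* The sign of [theta 0] is unknown. The guard replaces the term of index 0 by 0, so that every term
   of a series over all naturals is nonnegative. *)
transitivity (\int[mu]_z
    \sum_(0 <= i <oo) (if (1 <= i)%N then (h z)%:E * term i z else 0))%E.
  apply: eq_integral => z _; rewrite EFinM DE.
  rewrite eseries_cond -nneseriesZl; last by move=> i i1; exact: term_ge0.
  by rewrite eseries_mkcond.
rewrite integral_nneseries//; last 2 first.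
- move=> [|n] /=; first exact: measurable_cst.
  by apply: emeasurable_funM => //; exact/measurable_EFinP.
- by move=> [|n] z _ //=; apply: mule_ge0; [rewrite lee_fin|exact: term_ge0].
rewrite [RHS]eseries_cond [RHS]eseries_mkcond.
apply: eq_eseriesr => -[|i] _ /=; first by rewrite integral0.
rewrite (eq_integral (fun z => (c i.+1 * theta i.+1)%:E *
   (\1_(A i.+1) z)%:E))%E; last first.
  move=> z _; rewrite /term -!EFinM indicE.
  have [zi|zi] := boolP (z \in _); last by rewrite !mulr0.
  by rewrite !mulr1 (hc i.+1)//; exact: set_mem.
(* Nothing but the values of [h] on [A i.+1] constrains [c i.+1]; this set is nonempty because its
   measure is one, so [c i.+1] is a value of [h]. *)
have c0 : 0 <= c i.+1.
  have [[z zA]|nA] := pselect (exists z, A i.+1 z).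
    by rewrite -(hc i.+1 z).
  have A0 : A i.+1 = set0.
    by apply/seteqP; split=> // z zA; apply: nA; exists z.
  have /eqP := muA i.+1.
  by rewrite A0 measure0 eq_sym onee_eq0.
rewrite ge0_integralZl_EFin//=; last 2 first.
- by apply/measurable_EFinP.
- by rewrite mulr_ge0// ltW// theta_gt0.
by rewrite integral_indic// setIT muA mule1.
Qed.
End DiscreteDensity.

(** * Weighted L^r spaces: mixtures of densities, inclusion in L^1, sums *)

Section WeightedLp.
Context d (T : measurableType d) (R : realType) (mu : {measure set T -> \bar R}).

Definition density (w : T -> R) : Prop :=
  [/\ measurable_fun setT w, forall z, 0 < w z & (\int[mu]_z (w z)%:E = 1)%E].

Definition weighted_Lp (r : R) (w h : T -> R) : Prop :=
  measurable_fun setT h /\ (\int[mu]_z (`|h z| `^ r * w z)%:E < +oo)%E.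

Lemma measurable_powR_norm (r : R) (h : T -> R) :
  measurable_fun setT h -> measurable_fun setT (fun z => `|h z| `^ r).
Proof.
move=> mh; apply: (measurableT_comp (measurable_powR r)).
exact: measurableT_comp.
Qed.

Section Mixture.
Variables (A : nat -> set T) (theta : nat -> R) (D : T -> R).
Variables (alpha : R) (w0 : T -> R).
Hypothesis mA : forall i, measurable (A i).
Hypothesis muA : forall i, mu (A i) = 1%E.
Hypothesis theta_gt0 : forall i, (1 <= i)%N -> 0 < theta i.
Hypothesis DE : forall z,
  (D z)%:E = (\sum_(1 <= i <oo) (theta i * \1_(A i) z)%:E)%E.
Hypothesis alpha01 : 0 < alpha < 1.
Hypothesis w0_density : density w0.

Let w z := alpha * w0 z + (1 - alpha) * D z.
Let mD : measurable_fun setT D := measurable_discrete_density mA theta_gt0 DE.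
Let D0 : forall z, 0 <= D z := discrete_density_ge0 theta_gt0 DE.

Let alpha_gt0 : 0 < alpha. Proof. by case/andP: alpha01. Qed.
Let alphaC_gt0 : 0 < 1 - alpha.
Proof. by rewrite subr_gt0; case/andP: alpha01. Qed.

Lemma integral_mixture (h : T -> R) (c : nat -> R) :
  measurable_fun setT h -> (forall z, 0 <= h z) ->
  (forall i z, (1 <= i)%N -> A i z -> h z = c i) ->
  (\int[mu]_z (h z * w z)%:E =
   alpha%:E * (\int[mu]_z (h z * w0 z)%:E) +
   (1 - alpha)%:E * \sum_(1 <= i <oo) (c i * theta i)%:E)%E.
Proof.
move=> mh h0 hc; have [mw0 w0_gt0 _] := w0_density.
rewrite -(integral_discrete_density mA theta_gt0 DE muA mh h0 hc).
rewrite -ge0_integralZl_EFin//=; last 3 first.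
- by move=> z _; rewrite lee_fin mulr_ge0// ltW.
- by apply/measurable_EFinP/measurable_funM.
- exact: ltW.
rewrite -ge0_integralZl_EFin//=; last 3 first.
- by move=> z _; rewrite lee_fin mulr_ge0.
- by apply/measurable_EFinP/measurable_funM.
- exact: ltW.
rewrite -ge0_integralD//=; last 4 first.
- by move=> z _; rewrite mule_ge0// lee_fin ?mulr_ge0// ltW.
- by apply: emeasurable_funM => //; apply/measurable_EFinP/measurable_funM.
- by move=> z _; rewrite mule_ge0// lee_fin ?mulr_ge0// ltW.
- by apply: emeasurable_funM => //; apply/measurable_EFinP/measurable_funM.
apply: eq_integral => z _; rewrite -!EFinM -EFinD; congr _%:E.
by rewrite /w mulrDr !(mulrCA (h z)).
Qed.

Lemma density_mixture :
  (\sum_(1 <= i <oo) (theta i)%:E = 1)%E -> density w.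
Proof.
move=> theta1; have [mw0 w0_gt0 w01] := w0_density; split.
- by apply: measurable_funD; apply: measurable_funM.
- move=> z; rewrite ltr_pwDl ?mulr_gt0//.
  by rewrite mulr_ge0// ltW.
(* With [h] and [c] constantly 1, the mixture formula computes the total mass as
   [alpha + (1 - alpha)]. *)
- have := @integral_mixture (cst 1) (cst 1) (measurable_cst _) (fun=> ler01)
    (fun _ _ _ _ => erefl).
  under eq_integral do rewrite mul1r.
  under [X in (alpha%:E * X)%E]eq_integral do rewrite mul1r.
  under eq_eseriesr do rewrite mul1r.
  by move=> ->; rewrite w01 theta1 !mule1 -EFinD subrKC.
Qed.

(** The integral splits into two nonnegative parts with the positive weights [alpha] and
    [1 - alpha], so it is finite exactly when both parts are. All membership claims about the
    mixture reduce to this equivalence. *)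
Lemma weighted_Lp_mixture (r : R) (h : T -> R) (c : nat -> R) :
  (forall i z, (1 <= i)%N -> A i z -> `|h z| = c i) ->
  weighted_Lp r w h <->
  weighted_Lp r w0 h /\ (\sum_(1 <= i <oo) (c i `^ r * theta i)%:E < +oo)%E.
Proof.
move=> hc; have [mw0 w0_gt0 _] := w0_density.
have main : measurable_fun setT h ->
  (\int[mu]_z (`|h z| `^ r * w z)%:E < +oo)%E <->
  (\int[mu]_z (`|h z| `^ r * w0 z)%:E < +oo)%E /\
  (\sum_(1 <= i <oo) (c i `^ r * theta i)%:E < +oo)%E.
  move=> mh; rewrite (@integral_mixture _ (fun i => c i `^ r)
      (measurable_powR_norm r mh) (fun z => powR_ge0 _ _)); last first.
    by move=> i z i1 zi; rewrite (hc i).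
  set I := integral _ _ _; set S := (limn _).
  have I0 : (0 <= I)%E.
    by apply: integral_ge0 => z _; rewrite lee_fin mulr_ge0 ?powR_ge0// ltW.
  have S0 : (0 <= S)%E.
    apply: nneseries_ge0 => i i1 _.
    by rewrite lee_fin mulr_ge0 ?powR_ge0// ltW// theta_gt0.
  (* Nonnegativity excludes the value -oo. In the remaining cases an infinite part stays infinite
     after multiplication by its positive weight. *)
  by move: I S I0 S0 => [I| |] [S| |] // _ _;
    rewrite -?EFinM ?gt0_muley ?lte_fin// -?EFinD ?ltry; split=> // -[].
by split=> [[mh /(main mh)[]]|[[mh ?] ?]] //; split=> //; apply/main.
Qed.

End Mixture.

(** Pointwise |h| <= 1 + |h|^q, by comparing |h| with 1, and the constant 1 is integrable because
    [w] has mass one. *)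
Lemma weighted_Lp_Lp1 (q : R) (w h : T -> R) : 1 <= q ->
  density w -> weighted_Lp q w h -> weighted_Lp 1 w h.
Proof.
move=> q1 [mw w0 w1] [mh hq]; split; first exact: mh.
have mhq := measurable_powR_norm q mh.
apply: (@le_lt_trans _ _ (\int[mu]_z
  ((w z)%:E + (`|h z| `^ q * w z)%:E))%E).
  apply: ge0_le_integral => //=.
  - by move=> z _; rewrite lee_fin mulr_ge0 ?powR_ge0// ltW.
  - by apply/measurable_EFinP/measurable_funM => //; exact: measurable_powR_norm.
  - apply: emeasurable_funD; apply/measurable_EFinP => //.
    exact: measurable_funM.
  move=> z _; rewrite -EFinD lee_fin -{2}(mul1r (w z)) -mulrDl.
  apply: ler_wpM2r; first exact: ltW.
  rewrite powRr1//.
  have [h1|/ltW h1] := leP `|h z| 1.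
    by rewrite (le_trans h1)// lerDl powR_ge0.
  by rewrite -{1}(powRr1 (normr_ge0 (h z))) ler_wpDl// ler_powR.
rewrite ge0_integralD//=.
- by rewrite w1 lte_add_pinfty// ltry.
- by move=> z _; rewrite lee_fin ltW.
- exact/measurable_EFinP.
- by move=> z _; rewrite lee_fin mulr_ge0 ?powR_ge0// ltW.
- by apply/measurable_EFinP/measurable_funM.
Qed.

(** The sum is at most twice the larger of |a| and |b|, and the q-th power of the larger one is one
    of the two summands on the right. *)
Lemma powR_normD_le (q a b : R) : 0 <= q ->
  `|a + b| `^ q <= 2 `^ q * (`|a| `^ q + `|b| `^ q).
Proof.
move=> q0; apply: (@le_trans _ _ ((2 * Num.max `|a| `|b|) `^ q)).
  have m0 : 0 <= 2 * Num.max `|a| `|b| by rewrite mulr_ge0// le_max normr_ge0.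
  apply: ge0_ler_powR; rewrite ?nnegrE//.
  by rewrite (le_trans (ler_normD _ _))// mulr_natl mulr2n lerD// le_max
    lexx ?orbT.
rewrite powRM// ?le_max ?normr_ge0// ler_wpM2l ?powR_ge0//.
by case: (leP `|a| `|b|) => _; rewrite ?lerDl ?lerDr powR_ge0.
Qed.

Lemma weighted_Lp_add (q : R) (w h k : T -> R) : 0 <= q ->
  density w -> weighted_Lp q w h -> weighted_Lp q w k ->
  weighted_Lp q w (fun z => h z + k z).
Proof.
move=> q0 [mw w0 _] [mh hq] [mk kq].
have mhk : measurable_fun setT (fun z => h z + k z) by exact: measurable_funD.
have mhq := measurable_powR_norm q mh.
have mkq := measurable_powR_norm q mk.
split; first exact: mhk.
apply: (@le_lt_trans _ _ (\int[mu]_z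
  ((2 `^ q)%:E * ((`|h z| `^ q * w z)%:E + (`|k z| `^ q * w z)%:E)))%E).
  apply: ge0_le_integral => //=.
  - by move=> z _; rewrite lee_fin mulr_ge0 ?powR_ge0// ltW.
  - by apply/measurable_EFinP/measurable_funM => //; exact: measurable_powR_norm.
  - apply: emeasurable_funM => //.
    by apply: emeasurable_funD; apply/measurable_EFinP; exact: measurable_funM.
  move=> z _; rewrite -EFinD -EFinM lee_fin -mulrDl mulrA.
  by rewrite ler_wpM2r ?powR_normD_le// ltW.
rewrite ge0_integralZl_EFin//=; last 2 first.
- by move=> z _; rewrite adde_ge0// lee_fin mulr_ge0 ?powR_ge0// ltW.
- by apply: emeasurable_funD; apply/measurable_EFinP; exact: measurable_funM.
rewrite lte_mul_pinfty ?lee_fin ?powR_ge0// ge0_integralD//=.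
- exact: (lte_add_pinfty hq kq).
- by move=> z _; rewrite lee_fin mulr_ge0 ?powR_ge0// ltW.
- by apply/measurable_EFinP/measurable_funM.
- by move=> z _; rewrite lee_fin mulr_ge0 ?powR_ge0// ltW.
- by apply/measurable_EFinP/measurable_funM.
Qed.

End WeightedLp.

(** * Changing a density so that a given function becomes integrable *)

Section DampedDensity.
Context d (T : measurableType d) (R : realType) (mu : {measure set T -> \bar R}).

(** The density [p] witnesses that [mu] is not the zero measure. A zero integral would make [u]
    vanish almost everywhere; as [u] vanishes nowhere, the whole space would be null and [p] would
    have integral 0. *)
Lemma density_integral_gt0 (p u : T -> R) : density mu p ->
  measurable_fun setT u -> (forall z, 0 < u z) -> (0 < \int[mu]_z (u z)%:E)%E.
Proof.
move=> [mp p0 p1] mu' u0.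
have mue : measurable_fun setT (EFin \o u) by exact/measurable_EFinP.
have mpe : measurable_fun setT (EFin \o p) by exact/measurable_EFinP.
rewrite lt0e integral_ge0 ?andbT; last by move=> z _; rewrite lee_fin ltW.
apply/eqP => u_int0.
have /(ae_eq_integral_abs mu measurableT mue) u_ae0 :
    (\int[mu]_z `|(EFin \o u) z| = 0)%E.
  rewrite -[RHS]u_int0; apply: eq_integral => z _.
  by rewrite gee0_abs// lee_fin ltW.
have p_ae0 : ae_eq mu setT (EFin \o p) (cst 0%E).
  apply: filterS u_ae0 => z /(_ I) /= [uz0].
  by have := u0 z; rewrite uz0 ltxx.
have /eqP := p1.
rewrite (ge0_ae_eq_integral measurableT mpe (measurable_cst _) _ _ p_ae0).
- by rewrite integral0 eq_sym onee_eq0.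
- by move=> z _; rewrite lee_fin ltW.
- by [].
Qed.

(* The density is the normalisation of [p / (1 + F)]. *)
Lemma exists_density_integral_lty (p F : T -> R) : density mu p ->
  measurable_fun setT F -> (forall z, 0 <= F z) ->
  exists2 w, density mu w & (\int[mu]_z (F z * w z)%:E < +oo)%E.
Proof.
move=> dp mF F0; have [mp p0 p1] := dp.
have mpe : measurable_fun setT (EFin \o p) by exact/measurable_EFinP.
pose u z := p z * (1 + F z)^-1.
have F1 z : 0 < 1 + F z by rewrite ltr_pwDl.
have u0 z : 0 < u z by rewrite mulr_gt0// invr_gt0.
have mu_ : measurable_fun setT u.
  apply: measurable_funM => //.
  (* Writing the reciprocal as a real power brings it under the measurability of power functions. *)
  apply: (eq_measurable_fun (fun z => (1 + F z) `^ (-1))) => [z _|].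
    by rewrite powR_inv1// ltW.
  apply: (measurableT_comp (measurable_powR (-1))).
  exact: measurable_funD.
(* Applied twice: [G = 1] bounds the normalising constant [Z], and [G = F] bounds the integral of
   [F] before normalisation. *)
have le_int (G : T -> R) : measurable_fun setT G -> (forall z, 0 <= G z) ->
    (forall z, G z <= 1 + F z) -> (\int[mu]_z (G z * u z)%:E <= 1)%E.
  move=> mG G0 GF; rewrite -p1; apply: ge0_le_integral => //=.
  - by move=> z _; rewrite lee_fin mulr_ge0// ltW.
  - by apply/measurable_EFinP; exact: measurable_funM.
  - move=> z _; rewrite lee_fin mulrCA ler_piMr//; first exact: ltW.
    by rewrite ler_pdivrMr// mul1r.
set Z := (\int[mu]_z (u z)%:E)%E.
have Z0 : (0 < Z)%E by exact: density_integral_gt0 dp mu_ u0.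
have Z1 : (Z <= 1)%E.
  have := le_int (cst 1) (measurable_cst _) (fun=> ler01).
  under eq_integral do rewrite mul1r.
  by apply => z; rewrite lerDl.
have Zfin : Z \is a fin_num.
  by rewrite ge0_fin_numE ?(ltW Z0)// (le_lt_trans Z1)// ltry.
have fZ0 : 0 < fine Z by rewrite fine_gt0// Z0 (le_lt_trans Z1)// ltry.
have mG (G : T -> R) : measurable_fun setT G -> (forall z, 0 <= G z) ->
    (\int[mu]_z (G z * (fine Z)^-1)%:E = (fine Z)^-1%:E * \int[mu]_z (G z)%:E)%E.
  move=> mG G0; under eq_integral do rewrite mulrC EFinM.
  rewrite ge0_integralZl_EFin//.
  - by move=> z _; rewrite lee_fin.
  - exact/measurable_EFinP.
  - by rewrite invr_ge0 ltW.
exists (fun z => u z * (fine Z)^-1).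
  split.
  - exact: measurable_funM.
  - by move=> z; rewrite mulr_gt0// invr_gt0.
  - rewrite mG//; last by move=> z; exact: ltW.
    by rewrite -/Z -{2}(fineK Zfin) -EFinM mulVf// gt_eqF.
under eq_integral do rewrite mulrA.
rewrite mG; last 2 first.
- exact: measurable_funM.
- by move=> z; rewrite mulr_ge0// ltW.
rewrite lte_mul_pinfty ?lee_fin ?invr_ge0 ?(ltW fZ0)//.
by rewrite (le_lt_trans (le_int F _ _ _)) ?ltry// => z; rewrite lerDr.
Qed.
End DampedDensity.


(** * From the Borel plane to its Lebesgue completion *)

Local Notation leb2 R := (@lebesgue_measure R \x @lebesgue_measure R)%E.

Lemma borel_lebesgue_measurable2 (R : realType) (A : set (R * R)) :
  measurable A -> measurable (A : set (lebesgue_plane R)).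
Proof. by move=> mA; apply: caratheodory_measurable_mu_ext. Qed.

Lemma borel_fun_lebesgue_measurable2 (R : realType) (h : R * R -> R) :
  measurable_fun [set: R * R] h -> lebesgue_measurable2 h.
Proof.
move=> mh _ Y mY; apply: borel_lebesgue_measurable2; exact: mh.
Qed.

Lemma lebesgue_measure2_borel (R : realType) (A : set (R * R)) :
  measurable A -> lebesgue_measure2 (A : set (lebesgue_plane R)) = leb2 R A.
Proof. by move=> mA; apply: measurable_mu_extE. Qed.

(** The identity from the completed plane to the Borel plane is measurable and pushes the completed
    measure forward to the product measure, so this is a change of variables. It opens the way to
    Fubini-Tonelli for Borel integrands. *)
Lemma integral_lebesgue_measure2_borel (R : realType) (h : R * R -> \bar R) :
  measurable_fun [set: R * R] h -> (forall z, 0 <= h z)%E ->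
  (\int[@lebesgue_measure2 R]_z h z = \int[leb2 R]_z h z)%E.
Proof.
move=> mh h0.
(* [R] and [measurableTypeR R] have the same measurable sets but different
   displays; [lebesgue_measure] lives on the latter. *)
pose P := (measurableTypeR R * measurableTypeR R)%type.
have mid : @measurable_fun _ _ (lebesgue_plane R) P setT idfun.
  by move=> _ Y mY; rewrite setTI; apply: borel_lebesgue_measurable2.
have mhP : @measurable_fun _ _ P (\bar R) setT h by exact: mh.
pose nu : {measure set P -> \bar R} :=
  measure_function_pushforward__canonical__measure_function_Measure
    (@lebesgue_measure2 R) mid.
transitivity (\int[nu]_z h z)%E.
  by rewrite (@ge0_integral_pushforward _ _ (lebesgue_plane R)).
apply: eq_measure_integral => A mA _.
exact: lebesgue_measure2_borel.
Qed.

(** * The diagonal squares and a Gaussian density on the plane *)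

Definition diagonal_cell (R : realType) (i : nat) : set (R * R) :=
  [set` `[i%:R, i.+1%:R[] `*` [set` `[i%:R, i.+1%:R[].
Arguments diagonal_cell : clear implicits.

Lemma measurable_diagonal_cell (R : realType) (i : nat) :
  measurable (diagonal_cell R i).
Proof. exact: measurableX. Qed.

Lemma lebesgue_measure2_diagonal_cell (R : realType) (i : nat) :
  @lebesgue_measure2 R (diagonal_cell R i) = 1%E.
Proof.
rewrite lebesgue_measure2_borel; last exact: measurable_diagonal_cell.
have side : @lebesgue_measure R [set` `[i%:R, i.+1%:R[] = 1%E.
  rewrite lebesgue_measure_itv/= lte_fin ltr_nat ltnSn.
  by rewrite -EFinB -natrB// subSnn.
transitivity (@lebesgue_measure R [set` `[i%:R, i.+1%:R[] *
    @lebesgue_measure R [set` `[i%:R, i.+1%:R[])%E; last by rewrite side mule1.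
exact: product_measure1E.
Qed.

Lemma diagonal_term_indic (R : realType) (theta : nat -> R) i (z : R * R) :
  theta i * \1_(`[i%:R, i.+1%:R[) z.1 * \1_(`[i%:R, i.+1%:R[) z.2 =
  theta i * \1_(diagonal_cell R i) z.
Proof. by rewrite -mulrA !indicE in_setX -natrM mulnb. Qed.

Lemma diagonal_density_eseries (R : realType) (theta : nat -> R) (z : R * R) :
  (diagonal_density theta z)%:E =
  (\sum_(1 <= i <oo) (theta i * \1_(diagonal_cell R i) z)%:E)%E.
Proof.
rewrite /diagonal_density -EFin_lim; last first.
  (* From this index on the partial sums are constant: [z.1 < N <= i] keeps [z] out of the square of
     index [i]. The real limit therefore exists and agrees with the extended one. *)
  set N := (Num.trunc z.1).+1.
  apply: (is_cvg_near_cst (\sum_(1 <= i < N)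
    (theta i * \1_(`[i%:R, i.+1%:R[) z.1 * \1_(`[i%:R, i.+1%:R[) z.2))).
  exists N => // n /= Nn.
  rewrite (big_cat_nat _ Nn)//= [X in _ + X]big_nat.
  rewrite [X in _ + X]big1 ?addr0// => i /andP[Ni _].
  rewrite [\1__ z.1]indicE memNset ?mulr0 ?mul0r//= in_itv/= leNgt.
  by rewrite (lt_le_trans (truncnS_gt _)) ?ler_nat.
congr (limn _); apply/funext => n /=; rewrite -sumEFin.
by apply: eq_bigr => i _; rewrite diagonal_term_indic.
Qed.

(** The witness is the product of two standard Gaussian densities, whose mass is one by Tonelli. *)
Lemma exists_positive_density (R : realType) : exists p, @positive_density R p.
Proof.
have phi0 x : 0 < normal_pdf 0 1 x :> R.
  by rewrite normal_pdfE ?oner_eq0// mulr_gt0 ?expR_gt0// normal_peak_gt0 ?oner_eq0.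
pose p (z : R * R) := normal_pdf 0 1 z.1 * normal_pdf 0 1 z.2.
have mp : measurable_fun [set: R * R] p.
  apply: measurable_funM.
    exact: (measurableT_comp (measurable_normal_pdf 0 1) measurable_fst).
  exact: (measurableT_comp (measurable_normal_pdf 0 1) measurable_snd).
exists p; split.
- exact: borel_fun_lebesgue_measurable2.
- by move=> z; rewrite mulr_gt0.
rewrite integral_lebesgue_measure2_borel; last 2 first.
- exact/measurable_EFinP.
- by move=> z; rewrite lee_fin mulr_ge0// ltW.
pose P := (measurableTypeR R * measurableTypeR R)%type.
have mpP : @measurable_fun _ _ P (\bar R) setT (EFin \o p).
  by have /measurable_EFinP := mp.
rewrite (fubini_tonelli1 _ mpP); last by move=> z; rewrite lee_fin mulr_ge0// ltW.
rewrite -[RHS](@integral_normal_pdf R 0 1).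
apply: eq_integral => x _.
rewrite /fubini_F /p /=.
under eq_integral do rewrite EFinM.
rewrite ge0_integralZl_EFin//.
- by rewrite integral_normal_pdf mule1.
- by move=> y _; rewrite lee_fin ltW.
- by apply/measurable_EFinP; exact: measurable_normal_pdf.
- exact: ltW.
Qed.

(** * Failure of the Smirnov property for the mixture *)

Lemma in_x_diagonal_cell (R : realType) (f : R -> R) : const_on_unit_intervals f ->
  forall i z, (1 <= i)%N -> diagonal_cell R i z -> in_x f z = f i%:R.
Proof. by move=> fc i z i1 [zi _]; exact: fc. Qed.

Lemma in_y_diagonal_cell (R : realType) (g : R -> R) : const_on_unit_intervals g ->
  forall i z, (1 <= i)%N -> diagonal_cell R i z -> in_y g z = g i%:R.
Proof. by move=> gc i z i1 [_ zi]; exact: gc. Qed.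

(** The mixture criterion is applied with [c i] equal to |f_i|, |g_i| and |f_i + g_i|. The
    conditions on [w0] follow from the L^q hypotheses, through the inclusion in L^1 or stability
    under sums; the assumed series decide the rest. *)
Lemma mixture_not_smirnov (R : realType) (q : R) (w0 : R * R -> R)
    (f g : R -> R) (theta : nat -> R) (alpha : R) : 1 < q ->
  positive_density w0 ->
  const_on_unit_intervals f -> const_on_unit_intervals g ->
  Lw q w0 (in_x f) -> Lw q w0 (in_y g) ->
  (forall i : nat, (1 <= i)%N -> 0 < theta i) ->
  (\sum_(1 <= i <oo) (theta i)%:E = 1)%E ->
  (\sum_(1 <= i <oo) (`|f i%:R| `^ q * theta i)%:E = +oo)%E ->
  (\sum_(1 <= i <oo) (`|g i%:R| `^ q * theta i)%:E = +oo)%E ->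
  (\sum_(1 <= i <oo) (`|f i%:R| * theta i)%:E < +oo)%E ->
  (\sum_(1 <= i <oo) (`|g i%:R| * theta i)%:E < +oo)%E ->
  (\sum_(1 <= i <oo) (`|f i%:R + g i%:R| `^ q * theta i)%:E < +oo)%E ->
  0 < alpha < 1 ->
  let w := mixture alpha w0 theta in
  [/\ positive_density w,
      Lw 1 w (in_x f) /\ Lw 1 w (in_y g),
      Lw q w (fun z => in_x f z + in_y g z),
      ~ Lw q w (in_x f) &
      ~ Lw q w (in_y g)].
Proof.
move=> q1 dw0 fc gc fq gq theta0 theta1 fqoo gqoo f1 g1 fgq alpha01 w.
have fcell := in_x_diagonal_cell fc; have gcell := in_y_diagonal_cell gc.
have q0 : 0 <= q by rewrite (le_trans ler01)// ltW.
have mA i := borel_lebesgue_measurable2 (@measurable_diagonal_cell R i).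
have muA := @lebesgue_measure2_diagonal_cell R.
have DE := @diagonal_density_eseries R theta.
have wLp := @weighted_Lp_mixture _ _ _ (@lebesgue_measure2 R) _ _ _ _ _
  mA muA theta0 DE alpha01 dw0.
have xE r : Lw r w (in_x f) <->
    Lw r w0 (in_x f) /\ (\sum_(1 <= i <oo) (`|f i%:R| `^ r * theta i)%:E < +oo)%E.
  by apply: wLp => i z i1 zi; rewrite (fcell i).
have yE r : Lw r w (in_y g) <->
    Lw r w0 (in_y g) /\ (\sum_(1 <= i <oo) (`|g i%:R| `^ r * theta i)%:E < +oo)%E.
  by apply: wLp => i z i1 zi; rewrite (gcell i).
split.
- exact: (density_mixture mA muA theta0 DE alpha01 dw0 theta1).
- split; [apply/xE|apply/yE].
    split; first exact: (weighted_Lp_Lp1 (ltW q1) dw0 fq).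
    by under eq_eseriesr do rewrite powRr1//.
  split; first exact: (weighted_Lp_Lp1 (ltW q1) dw0 gq).
  by under eq_eseriesr do rewrite powRr1//.
- apply/(wLp _ _ (fun i => `|f i%:R + g i%:R|)).
    by move=> i z i1 zi; rewrite (fcell i)// (gcell i).
  by split; first exact: (weighted_Lp_add q0 dw0 fq gq).
- by move=> /xE[_]; rewrite fqoo.
- by move=> /yE[_]; rewrite gqoo.
Qed.

(** * Geometric series and an explicit counterexample *)

Lemma nneseries_shift1 (R : realType) (a : nat -> R) : (forall i, 0 <= a i) ->
  (\sum_(1 <= i <oo) (a i)%:E = \sum_(0 <= i <oo) (a i.+1)%:E)%E.
Proof.
move=> a0; rewrite -(@nneseries_addn _ (EFin \o a) 1); last first.
  by move=> i; rewrite lee_fin.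
by apply: eq_eseriesr => i _; rewrite addn1.
Qed.

Lemma eseries_expr (R : realType) (z : R) : 0 <= z < 1 ->
  (\sum_(1 <= i <oo) (z ^+ i)%:E = (z / (1 - z))%:E)%E.
Proof.
case/andP=> z0 z1; rewrite nneseries_shift1; last by move=> i; exact: exprn_ge0.
have z1' : `|z| < 1 by rewrite ger0_norm.
rewrite -(cvg_lim _ (cvg_geometric_series (a := z) z1'))// -EFin_lim; last first.
  exact: is_cvg_geometric_series.
congr (limn _); apply/funext => n /=; rewrite -sumEFin.
by apply: eq_bigr => i _; rewrite exprS.
Qed.

Lemma eseries_cst1 (R : realType) : (\sum_(1 <= i <oo) (1 : R)%:E = +oo)%E.
Proof.
rewrite (@nneseries_shift1 _ (cst 1)) //.
apply/cvg_lim => //.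
rewrite (_ : (fun _ => _) = (EFin \o (fun n => n%:R : R))); last first.
  by apply/funext => n /=; rewrite sumEFin big_mkord sumr_const card_ord.
apply/cvgeryP; exact: cvgr_idn.
Qed.

(* [c = 2 `^ q^-1] satisfies [c < 2 = c `^ q], so [f i = c ^+ i] and
   [theta i = 2 ^- i] give [`|f i| `^ q * theta i = 1] but a convergent
   geometric series [`|f i| * theta i]; taking [g = - f] makes [f + g] vanish. *)
Lemma exists_density_not_smirnov (R : realType) (q : R) : 1 < q ->
  exists w : R * R -> R, positive_density w /\ ~ smirnov_property q w.
Proof.
move=> q1; have q0 : 0 < q by rewrite (lt_trans ltr01).
pose c : R := 2 `^ q^-1.
have c_ge1 : 1 <= c by rewrite -(powRr0 2) ler_powR ?ler1n// invr_ge0 ltW.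
have c0 : 0 < c by rewrite (lt_le_trans ltr01).
have c_lt2 : c < 2.
  (* On exponents the claim reads ln 2 / q < ln 2, which holds because [q > 1]. *)
  rewrite -[ltRHS](@lnK R) ?posrE// /c /powR pnatr_eq0/= ltr_expR.
  by rewrite gtr_pMl ?invf_lt1// ln_gt0// ltr1n.
have cq : c `^ q = 2 by rewrite -powRrM mulVf ?gt_eqF// powRr1.
(* [Num.trunc] is 0 on negative reals, so [f] equals 1 there and is nondecreasing on the whole line
   because [c >= 1]; monotonicity gives its measurability. *)
pose f (x : R) := c ^+ Num.trunc x.
have f_ge0 x : 0 <= f x by rewrite exprn_ge0// ltW.
have fnat (i : nat) : f i%:R = c ^+ i by rewrite /f natrK.
have mf : measurable_fun [set: R] f.
  apply: nondecreasing_measurable => // x y xy.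
  by rewrite ler_weXn2l// le_truncn.
have fc : const_on_unit_intervals f.
  move=> i _ x; rewrite in_itv/= => xi.
  by rewrite fnat /f (truncn_def xi).
pose theta (i : nat) : R := 2^-1 ^+ i.
have theta0 i : 0 < theta i by rewrite exprn_gt0// invr_gt0.
have half01 : 0 <= (2^-1 : R) < 1 by rewrite invr_ge0 ler0n/= invf_lt1// ltr1n.
have theta1 : (\sum_(1 <= i <oo) (theta i)%:E = 1)%E.
  by rewrite eseries_expr//; congr _%:E; field.
have fq i : `|f i%:R| `^ q * theta i = 1.
  rewrite ger0_norm// fnat -powR_mulrn ?(ltW c0)// -powRrM (mulrC i%:R) powRrM.
  by rewrite cq powR_mulrn// /theta exprVn mulfV//.
have f1 : (\sum_(1 <= i <oo) (`|f i%:R| * theta i)%:E < +oo)%E.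
  rewrite (eq_eseriesr (g := fun i => ((c / 2) ^+ i)%:E)); last first.
    by move=> i _; rewrite ger0_norm// fnat /theta -exprMn.
  rewrite eseries_expr ?ltry// divr_ge0 ?(ltW c0)//= ltr_pdivrMr// mul1r//.
have [p dp] := exists_positive_density R.
have mfx : lebesgue_measurable2 (in_x f).
  apply: borel_fun_lebesgue_measurable2.
  exact: (measurableT_comp mf measurable_fst).
have mfy : lebesgue_measurable2 (in_y f).
  apply: borel_fun_lebesgue_measurable2.
  exact: (measurableT_comp mf measurable_snd).
have mfxq := measurable_powR_norm q mfx.
have mfyq := measurable_powR_norm q mfy.
(* Damping the Gaussian by |f(x)|^q + |f(y)|^q puts both one-variable functions in L^q of [w0] at
   once, without moment estimates. *)
have [w0 dw0 w0oo] := exists_density_integral_lty dp (measurable_funD mfxq mfyq)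
  (fun z => addr_ge0 (powR_ge0 _ _) (powR_ge0 _ _)).
have [mw0 w0_gt0 _] := dw0.
have dominated (h : R * R -> R) : lebesgue_measurable2 h ->
    (forall z, `|h z| `^ q <= `|in_x f z| `^ q + `|in_y f z| `^ q) -> Lw q w0 h.
  move=> mh hF; split; first exact: mh.
  apply: le_lt_trans w0oo; apply: (ge0_le_integral _ measurableT).
  - by move=> z _; rewrite lee_fin mulr_ge0 ?powR_ge0// ltW.
  - apply/measurable_EFinP; apply: measurable_funM; last exact: mw0.
    exact: measurable_powR_norm.
  - apply/measurable_EFinP; apply: measurable_funM; last exact: mw0.
    exact: (measurable_funD mfxq mfyq).
  - by move=> z _; rewrite lee_fin; apply: ler_wpM2r; first exact: ltW.
pose g x := - f x.
have gc : const_on_unit_intervals g by move=> i i1 x xi; rewrite /g (fc i).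
have mgy : lebesgue_measurable2 (in_y g).
  apply: borel_fun_lebesgue_measurable2.
  exact: (measurableT_comp (measurable_funN mf) measurable_snd).
have fxq : Lw q w0 (in_x f) by apply: dominated => // z; rewrite lerDl powR_ge0.
have gyq : Lw q w0 (in_y g).
  by apply: dominated => // z; rewrite /in_y normrN lerDr powR_ge0.
have foo : (\sum_(1 <= i <oo) (`|f i%:R| `^ q * theta i)%:E = +oo)%E.
  by under eq_eseriesr do rewrite fq; exact: eseries_cst1.
have half_itv : 0 < (2^-1 : R) < 1 by rewrite invr_gt0 ltr0n/=; case/andP: half01.
(* The weight 1/2 is an arbitrary choice in (0, 1). The remaining goals are the series for [g],
   which are those for [f] by parity of the norm, and the series for [f + g]. *)
have [] := @mixture_not_smirnov R q w0 f g theta 2^-1 q1 dw0 fc gc fxq gyq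
  (fun i _ => theta0 i) theta1 foo _ f1 _ _ half_itv.
- by under eq_eseriesr do rewrite normrN.
- by under eq_eseriesr do rewrite normrN.
(* The power of 0 with exponent 0 is 1 by convention, so the vanishing of these terms uses that [q]
   is nonzero. *)
- under eq_eseriesr do rewrite subrr normr0 powR0 ?gt_eqF// mul0r.
  by rewrite eseries0// ltry.
move=> dw [fw1 gw1] fgw nfw _; exists (mixture 2^-1 w0 theta); split.
  exact: dw.
move=> smirnov; have [fwq _] := smirnov f g fw1 gw1 fgw; exact: nfw fwq.
Qed.

Theorem mainTheorem4 (R : realType) (q : R) (hq : 1 < q) :
  (exists w : R * R -> R, positive_density w /\ ~ smirnov_property q w) /\
  (forall (w0 : R * R -> R) (f g : R -> R) (theta : nat -> R) (alpha : R),
    positive_density w0 ->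
    lebesgue_measurable1 f -> lebesgue_measurable1 g ->
    const_on_unit_intervals f -> const_on_unit_intervals g ->
    Lw q w0 (in_x f) -> Lw q w0 (in_y g) ->
    (forall i : nat, (1 <= i)%N -> 0 < theta i) ->
    (\sum_(1 <= i <oo) (theta i)%:E = 1)%E ->
    (\sum_(1 <= i <oo) (`|f i%:R| `^ q * theta i)%:E = +oo)%E ->
    (\sum_(1 <= i <oo) (`|g i%:R| `^ q * theta i)%:E = +oo)%E ->
    (\sum_(1 <= i <oo) (`|f i%:R| * theta i)%:E < +oo)%E ->
    (\sum_(1 <= i <oo) (`|g i%:R| * theta i)%:E < +oo)%E ->
    (\sum_(1 <= i <oo) (`|f i%:R + g i%:R| `^ q * theta i)%:E < +oo)%E ->
    0 < alpha < 1 ->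
    let w := mixture alpha w0 theta in
    [/\ positive_density w,
        Lw 1 w (in_x f) /\ Lw 1 w (in_y g),
        Lw q w (fun z => in_x f z + in_y g z),
        ~ Lw q w (in_x f) &
        ~ Lw q w (in_y g)]).
Proof.
split; first exact: exists_density_not_smirnov.
move=> w0 f g theta alpha dw0 _ _; exact: mixture_not_smirnov.
Qed.
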